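(* Let $\varphi:\mathbb{R}^n\to\overline{\mathbb{R}}$ be continuously prox-regular at $\bar x\in\operatorname{dom}\varphi$ for $0\in\partial\varphi(\bar x)$, and let $\sigma>0$. Then the following assertions are equivalent: (i) $\varphi$ is variationally strongly convex at $\bar x$ for $\bar v=0$ with modulus $\sigma$. (ii) $\bar x$ is a tilt-stable local minimizer of $\varphi$ with modulus $\sigma^{-1}$. (iii) $\partial\varphi$ is locally strongly monotone around $(\bar x,0)$ with modulus $\sigma$.
   Context: Conventions: $\overline{\mathbb{R}}:=(-\infty,\infty]$; every extended-real-valued function is assumed proper, i.e. $\operatorname{dom}\varphi:=\{x\mid\varphi(x)<\infty\}\neq\emptyset$. $\mathbb{B}_\epsilon(a)$ is the closed ball with center $a$ and radius $\epsilon$; l.s.c. means lower semicontinuous. Subdifferentials: for $\bar x\in\operatorname{dom}\varphi$, $$\widehat\partial\varphi(\bar x)=\Big\{v\in\mathbb{R}^n\;\Big|\;\liminf_{x\to\bar x}\frac{\varphi(x)-\varphi(\bar x)-\langle v,x-\bar x\rangle}{\|x-\bar x\|}\ge 0\Big\},$$ and the limiting subdifferential $\partial\varphi(\bar x)$ is the set of all $v$ for which there are $x_k\to\bar x$ with $\varphi(x_k)\to\varphi(\bar x)$ and $v_k\in\widehat\partial\varphi(x_k)$ with $v_k\to v$. Variational strong convexity: an l.s.c. function $\varphi$ is variationally strongly convex at $\bar x$ for $\bar v\in\partial\varphi(\bar x)$ with modulus $\sigma>0$ if for some convex neighborhood $U\times V$ of $(\bar x,\bar v)$ there exist an l.s.c.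 function $\psi\le\varphi$ on $U$ that is strongly convex on $U$ with modulus $\sigma$ (i.e. $\psi-\frac\sigma2\|\cdot\|^2$ is convex on $U$) and a number $\epsilon>0$ such that $$(U_\epsilon\times V)\cap\operatorname{gph}\partial\varphi=(U\times V)\cap\operatorname{gph}\partial\psi\quad\text{and}\quad\varphi(x)=\psi(x)\ \text{at the common elements }(x,v),$$ where $U_\epsilon:=\{x\in U\mid\varphi(x)<\varphi(\bar x)+\epsilon\}$. Continuous prox-regularity at $\bar x$ for $\bar v$ means that $\varphi$ is both prox-regular and subdifferentially continuous at $\bar x$ for $\bar v$. An l.s.c. function $\varphi$ is prox-regular at $\bar x$ for $\bar v\in\partial\varphi(\bar x)$ if there exist $\epsilon>0$ and $r\ge0$ such that $\varphi(x)\ge\varphi(u)+\langle v,x-u\rangle-\frac r2\|x-u\|^2$ for all $x\in\mathbb{B}_\epsilon(\bar x)$ and all $(u,v)\in\operatorname{gph}\partial\varphi\cap(\mathbb{B}_\epsilon(\bar x)\times\mathbb{B}_\epsilon(\bar v))$ with $\varphi(u)<\varphi(\bar x)+\epsilon$. It is subdifferentially continuous at $\bar x$ for $\bar v$ if for every $\epsilon>0$ there is $\delta>0$ such that $|\varphi(x)-\varphi(\bar x)|<\epsilon$ whenever $(x,v)\in\operatorname{gph}\partial\varphi\cap(\mathbb{B}_\delta(\bar x)\times\mathbb{B}_\delta(\bar v))$. Tilt stability: $\bar x\in\operatorname{dom}\varphi$ is a tilt-stable local minimizer of $\varphi$ with modulus $\kappa>0$ if there exists $\gamma>0$ such that the mapping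 $M_\gamma:v\mapsto\operatorname{argmin}\{\varphi(x)-\langle v,x\rangle\mid x\in\mathbb{B}_\gamma(\bar x)\}$ is single-valued and Lipschitz continuous with constant $\kappa$ on some neighborhood of $0\in\mathbb{R}^n$, with $M_\gamma(0)=\{\bar x\}$. Local strong monotonicity: a set-valued mapping $T:\mathbb{R}^n\rightrightarrows\mathbb{R}^n$ is locally strongly monotone around $(\bar x,\bar v)\in\operatorname{gph}T$ with modulus $\sigma>0$ if there is a neighborhood $W$ of $(\bar x,\bar v)$ such that $\langle v_1-v_2,u_1-u_2\rangle\ge\sigma\|u_1-u_2\|^2$ for all $(u_1,v_1),(u_2,v_2)\in\operatorname{gph}T\cap W$. *)

(* Defs.v *)
From HB Require Import structures.
From mathcomp Require Import all_boot all_order all_algebra.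
From mathcomp Require Import all_classical all_reals all_analysis.

Set Implicit Arguments.
Unset Strict Implicit.
Unset Printing Implicit Defensive.

Import Order.TTheory GRing.Theory Num.Theory.
Import numFieldNormedType.Exports.

Local Open Scope classical_set_scope.
Local Open Scope ring_scope.

Section euclidean.
Context {R : realType} {n : nat}.
Implicit Types u v x a : 'rV[R]_n.

Definition dot u v : R := \sum_(i < n) u ord0 i * v ord0 i.

(* The library norm `|x| on 'rV[R]_n is the sup norm: it induces the usual
   topology, so the library's nbhs and limits are used below, but metric
   inequalities must be written with the Euclidean norm. *)
Definition enorm x : R := Num.sqrt (dot x x).

Definition eball a (r : R) : set 'rV[R]_n := [set x | enorm (x - a) <= r].

End euclidean.

Section extended_real_valued.
Context {R : realType} {n : nat}.
Implicit Types (phi psi : 'rV[R]_n -> \bar R) (x v xb vb : 'rV[R]_n).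

Definition dom phi : set 'rV[R]_n := [set x | (phi x < +oo)%E].

(* The first conjunct restricts the codomain \bar R to (-oo, +oo]. *)
Definition proper_function phi : Prop :=
  (forall x, phi x != -oo%E) /\ dom phi !=set0.

Definition gph (T : 'rV[R]_n -> set 'rV[R]_n) : set ('rV[R]_n * 'rV[R]_n) :=
  [set p | T p.1 p.2].

(* The liminf is over the punctured neighborhoods of xb, so the quotient by a
   zero norm is never evaluated. *)
Definition frechet_subdiff phi xb : set 'rV[R]_n :=
  [set v | dom phi xb /\
    (0 <= limf_einf
            (fun x => (phi x - phi xb - (dot v (x - xb))%:E) *
                      ((enorm (x - xb))^-1)%:E) xb^')%E].

Definition limiting_subdiff phi xb : set 'rV[R]_n :=
  [set v | dom phi xb /\
    exists x_ v_ : nat -> 'rV[R]_n,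
      [/\ x_ k @[k --> \oo] --> xb,
          phi (x_ k) @[k --> \oo] --> phi xb,
          forall k, frechet_subdiff phi (x_ k) (v_ k)
        & v_ k @[k --> \oo] --> v]].

Definition econvex_on (U : set 'rV[R]_n) (f : 'rV[R]_n -> \bar R) : Prop :=
  forall x y (t : R), U x -> U y -> 0 <= t <= 1 ->
    (f ((t *: x + (1 - t) *: y)%R) <= t%:E * f x + (1 - t)%:E * f y)%E.

Definition strongly_convex_on (U : set 'rV[R]_n) (sigma : R) psi : Prop :=
  econvex_on U (fun x => psi x - (sigma / 2 * enorm x ^+ 2)%:E)%E.

Definition variationally_strongly_convex phi xb vb (sigma : R) : Prop :=
  [/\ lower_semicontinuous phi, limiting_subdiff phi xb vb &
  exists (U V : set 'rV[R]_n) (psi : 'rV[R]_n -> \bar R) (eps : R),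
    let U_eps := [set x | U x /\ (phi x < phi xb + eps%:E)%E] in
    [/\ [/\ nbhs xb U, convex_set U, nbhs vb V & convex_set V],
        [/\ proper_function psi, lower_semicontinuous psi,
            forall x, U x -> (psi x <= phi x)%E
          & strongly_convex_on U sigma psi],
        0 < eps,
        (U_eps `*` V) `&` gph (limiting_subdiff phi) =
          (U `*` V) `&` gph (limiting_subdiff psi)
      & forall x v, ((U_eps `*` V) `&` gph (limiting_subdiff phi)) (x, v) ->
          phi x = psi x]].

Definition prox_regular phi xb vb : Prop :=
  [/\ lower_semicontinuous phi, limiting_subdiff phi xb vb &
  exists eps r : R,
    [/\ 0 < eps, 0 <= r &
        forall x u v, eball xb eps x ->
          gph (limiting_subdiff phi) (u, v) ->
          eball xb eps u -> eball vb eps v ->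
          (phi u < phi xb + eps%:E)%E ->
          (phi u + (dot v (x - u))%:E - (r / 2 * enorm (x - u) ^+ 2)%:E
             <= phi x)%E]].

Definition subdiff_continuous phi xb vb : Prop :=
  forall eps : R, 0 < eps -> exists delta : R, 0 < delta /\
    forall x v, gph (limiting_subdiff phi) (x, v) ->
      eball xb delta x -> eball vb delta v ->
      (`|phi x - phi xb| < eps%:E)%E.

Definition continuously_prox_regular phi xb vb : Prop :=
  prox_regular phi xb vb /\ subdiff_continuous phi xb vb.

Definition argmin (f : 'rV[R]_n -> \bar R) (C : set 'rV[R]_n) :
    set 'rV[R]_n :=
  [set x | C x /\ forall y, C y -> (f x <= f y)%E].

Definition tilt_argmin phi xb (gamma : R) v : set 'rV[R]_n :=
  argmin (fun x => phi x - (dot v x)%:E)%E (eball xb gamma).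

Definition tilt_stable_local_minimizer phi xb (kappa : R) : Prop :=
  dom phi xb /\
  exists gamma : R, [/\ 0 < gamma,
    tilt_argmin phi xb gamma 0 = [set xb] &
    exists (N : set 'rV[R]_n) (m : 'rV[R]_n -> 'rV[R]_n),
      [/\ nbhs (0 : 'rV[R]_n) N,
          forall v, N v -> tilt_argmin phi xb gamma v = [set m v]
        & forall v1 v2, N v1 -> N v2 ->
            enorm (m v1 - m v2) <= kappa * enorm (v1 - v2)]].

Definition locally_strongly_monotone (T : 'rV[R]_n -> set 'rV[R]_n)
    xb vb (sigma : R) : Prop :=
  gph T (xb, vb) /\
  exists W : set ('rV[R]_n * 'rV[R]_n), nbhs (xb, vb) W /\
    forall u1 v1 u2 v2,
      (gph T `&` W) (u1, v1) -> (gph T `&` W) (u2, v2) ->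
      sigma * enorm (u1 - u2) ^+ 2 <= dot (v1 - v2) (u1 - u2).

End extended_real_valued.

(* Main.v *)
(** Proof idea: (i) => (iii) => (ii) => (i).

    (i) => (iii): limiting subgradients of a strongly convex function satisfy
    the strengthened subgradient inequality; adding two of them gives
    strong monotonicity, and subdifferential continuity puts nearby subgradients
    of [phi] into the localization [U_eps].

    (iii) => (ii): the Moreau envelope of [phi] is bounded below by
    prox-regularity, and strong monotonicity makes it grow along segments
    issuing from [xb], so [phi] has quadratic growth at [xb].  Minimisers of
    slightly tilted functions are then interior, hence critical, and strong
    monotonicity makes them unique and Lipschitz.

    (ii) => (i): the argmin map [m] is the gradient of the convex conjugate [g]
    of the localized [phi], so the Lipschitz bound on [m] gives
    a quadratic upper bound on [g], that is, the uniform growth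
    [phi x >= phi (m v) + <v, x - m v> + sigma / 2 |x - m v|^2].  The supremum
    over small [v] of the right-hand sides is the required [psi].
    Prox-regularity shows that every subgradient [v] of [phi] at [u] near
    [(xb, 0)] has [u = m v]: the shifted map [v + r m v] is strongly monotone
    and Lipschitz, hence locally onto. *)

Require Import Defs.
From mathcomp Require Import all_boot all_order all_algebra.
From mathcomp Require Import all_classical all_reals all_analysis.
From mathcomp Require Import ring lra.

Import Order.TTheory GRing.Theory Num.Theory.
Import numFieldNormedType.Exports.

Local Open Scope classical_set_scope.
Local Open Scope ring_scope.

(** * The Euclidean norm on row vectors *)

Section euclidean.
Context {R : realType} {n : nat}.
Implicit Types (u v w x y : 'rV[R]_n) (a b c d t : R).

Lemma dotC u v : dot u v = dot v u.
Proof. by apply: eq_bigr => i _; rewrite mulrC. Qed.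

Lemma dotDl u v w : dot (u + v) w = dot u w + dot v w.
Proof. by rewrite -big_split; apply: eq_bigr => i _; rewrite mxE mulrDl. Qed.

Lemma dotDr u v w : dot w (u + v) = dot w u + dot w v.
Proof. by rewrite dotC dotDl !(dotC w). Qed.

Lemma dotZl a u v : dot (a *: u) v = a * dot u v.
Proof. by rewrite mulr_sumr; apply: eq_bigr => i _; rewrite mxE mulrA. Qed.

Lemma dotZr a u v : dot u (a *: v) = a * dot u v.
Proof. by rewrite dotC dotZl dotC. Qed.

Lemma dotNl u v : dot (- u) v = - dot u v.
Proof. by rewrite -scaleN1r dotZl mulN1r. Qed.

Lemma dotNr u v : dot u (- v) = - dot u v.
Proof. by rewrite dotC dotNl dotC. Qed.

Lemma dot0l v : dot 0 v = 0.
Proof. by rewrite -(scale0r v) dotZl mul0r. Qed.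

Lemma dot0r v : dot v 0 = 0.
Proof. by rewrite dotC dot0l. Qed.

Definition dotE := (dotDl, dotDr, dotNl, dotNr, dotZl, dotZr, dot0l, dot0r).

Lemma dot_ge0 u : 0 <= dot u u.
Proof. by apply: sumr_ge0 => i _; exact: sqr_ge0. Qed.

Lemma dot_eq0 u : dot u u = 0 -> u = 0.
Proof.
move=> /eqP; rewrite psumr_eq0 => [/allP u0|i _]; last exact: sqr_ge0.
apply/rowP => i; rewrite mxE; apply/eqP.
by have := u0 i (mem_index_enum i); rewrite mulf_eq0 orbb.
Qed.

Lemma enorm_sqr u : enorm u ^+ 2 = dot u u.
Proof. by rewrite sqr_sqrtr // dot_ge0. Qed.

Lemma enorm_combB_sqr a u b v : enorm (a *: u - b *: v) ^+ 2 =
  a ^+ 2 * enorm u ^+ 2 - 2 * a * b * dot u v + b ^+ 2 * enorm v ^+ 2.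
Proof. by rewrite !enorm_sqr !dotE (dotC v u); ring. Qed.

Lemma enormB_sqr u v :
  enorm (u - v) ^+ 2 = enorm u ^+ 2 - 2 * dot u v + enorm v ^+ 2.
Proof.
by have := enorm_combB_sqr 1 u 1 v; rewrite !scale1r !expr1n !mulr1 !mul1r.
Qed.

Lemma enorm_ge0 u : 0 <= enorm u.
Proof. exact: sqrtr_ge0. Qed.

Lemma enorm0 : enorm (0 : 'rV[R]_n) = 0.
Proof. by rewrite /enorm dot0l sqrtr0. Qed.

Lemma enorm0_eq0 u : enorm u = 0 -> u = 0.
Proof. by move=> u0; apply: dot_eq0; rewrite -enorm_sqr u0 expr0n. Qed.

Lemma enorm_gt0 u : u != 0 -> 0 < enorm u.
Proof.
move=> u0; rewrite lt_neqAle enorm_ge0 andbT eq_sym.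
by apply: contra_neq u0; exact: enorm0_eq0.
Qed.

Lemma enormZ a u : enorm (a *: u) = `|a| * enorm u.
Proof.
by rewrite /enorm dotZl dotZr mulrA -expr2 sqrtrM ?sqr_ge0 // sqrtr_sqr.
Qed.

Lemma enormN u : enorm (- u) = enorm u.
Proof. by rewrite /enorm dotNl dotNr opprK. Qed.

Lemma enormB u v : enorm (u - v) = enorm (v - u).
Proof. by rewrite -enormN opprB. Qed.

Lemma le_enorm u c : 0 <= c -> dot u u <= c ^+ 2 -> enorm u <= c.
Proof. by move=> c0; rewrite -enorm_sqr ler_sqr ?nnegrE ?enorm_ge0. Qed.

(** Cauchy-Schwarz: the squared norm of [|v| u - |u| v] is [2 |u| |v| (|u| |v| - <u, v>)]. *)
Lemma dot_le_enorm u v : dot u v <= enorm u * enorm v.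
Proof.
have [->|v0] := eqVneq v 0; first by rewrite dot0r enorm0 mulr0.
have v_gt0 := enorm_gt0 _ v0.
have [->|u0] := eqVneq u 0; first by rewrite dot0l enorm0 mul0r.
have u_gt0 := enorm_gt0 _ u0.
have := dot_ge0 (enorm v *: u - enorm u *: v).
rewrite !dotE -!enorm_sqr (dotC v) => h.
rewrite -subr_ge0 -(pmulr_rge0 _ (mulr_gt0 u_gt0 v_gt0)); nra.
Qed.

Lemma enormD u v : enorm (u + v) <= enorm u + enorm v.
Proof.
apply: le_enorm; first by rewrite addr_ge0 ?enorm_ge0.
rewrite !dotE -!enorm_sqr (dotC v); have := dot_le_enorm u v; nra.
Qed.

Lemma enormD_ball u v a b :
  enorm u <= a -> enorm v <= b -> enorm (u + v) <= a + b.
Proof. by move=> ua vb; apply: le_trans (enormD u v) _; rewrite lerD. Qed.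

Lemma enorm_triangle u v w : enorm (u - w) <= enorm (u - v) + enorm (v - w).
Proof. by rewrite -[u - w](subrKA v); exact: enormD. Qed.

Lemma coord_le_enorm u i : `|u ord0 i| <= enorm u.
Proof.
rewrite -(@ler_sqr R) ?nnegrE ?enorm_ge0 // enorm_sqr /dot (bigD1 i) //=.
by rewrite real_normK ?num_real // lerDl sumr_ge0 // => j _; exact: sqr_ge0.
Qed.

Lemma cvg_dot T (F : set_system T) {FF : Filter F}
    (f g : T -> 'rV[R]_n) u v :
  f @ F --> u -> g @ F --> v -> (fun k => dot (f k) (g k)) @ F --> dot u v.
Proof.
move=> fu gv.
have coordE (h : T -> 'rV[R]_n) w i :
    h @ F --> w -> h k ord0 i @[k --> F] --> w ord0 i.
  move=> hw; have := @coord_continuous _ _ _ ord0 i w.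
  by move=> /(cvg_comp _ _ hw).
apply: cvg_big => [|i _]; first exact: add_continuous.
by apply: cvgM; exact: coordE.
Qed.

Lemma cvg_enorm T (F : set_system T) {FF : Filter F}
    (f : T -> 'rV[R]_n) u :
  f @ F --> u -> (fun k => enorm (f k)) @ F --> enorm u.
Proof.
move=> fu; have := @sqrt_continuous R (dot u u).
by move=> /(cvg_comp _ _ (cvg_dot _ _ _ _ _ _ fu fu)).
Qed.

Lemma enormB_continuous u : continuous (fun x => enorm (x - u)).
Proof.
move=> v; have vu : x - u @[x --> v] --> v - u.
  apply: (@cvgB _ _ _ (nbhs v) _ id (cst u)); [exact: cvg_id | exact: cvg_cst].
exact: cvg_enorm vu.
Qed.

Lemma near_enorm u c : 0 < c -> \forall x \near u, enorm (x - u) < c.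
Proof.
move=> c0.
have := enormB_continuous u u; rewrite /continuous_at subrr enorm0.
by move=> /cvgr_lt; exact.
Qed.

Lemma nbhs_eball u c : 0 < c -> nbhs u (eball u c).
Proof. by move=> c0; apply: filterS (near_enorm u c c0) => x /ltW. Qed.

(** The sup norm behind [nbhs] is at most [enorm]; halving the radius makes the inequality
    strict. *)
Lemma nbhs_enormP u (N : set 'rV[R]_n) :
  nbhs u N -> exists2 c, 0 < c & eball u c `<=` N.
Proof.
move=> /nbhs_ballP[e /= e0 uN]; exists (e / 2); first by rewrite divr_gt0.
move=> x xu; apply: uN; rewrite -ball_normE /= distrC.
rewrite /Num.norm /= mx_normrE; apply: (@le_lt_trans _ _ (e / 2)).
  apply/bigmax_leP; split => [|[i j] _ /=]; first by rewrite divr_ge0 // ltW.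
  by rewrite ord1; apply: le_trans (coord_le_enorm _ _) xu.
by rewrite ltr_pdivrMr // ltr_pMr // ltr1n.
Qed.

Lemma compact_eball u c : compact (eball u c).
Proof.
apply: bounded_closed_compact.
  exists (c + enorm u); split; first exact: num_real.
  move=> M cM x xuc; rewrite /Num.norm /= mx_normrE.
  have xM : enorm x <= M.
    rewrite -[x](subrK u).
    exact: le_trans (enormD_ball _ _ _ _ xuc (lexx _)) (ltW cM).
  apply/bigmax_leP; split => [|[i j] _ /=].
    exact: le_trans (enorm_ge0 x) xM.
  by rewrite ord1; apply: le_trans (coord_le_enorm _ _) xM.
rewrite (_ : eball u c = (fun x => enorm (x - u)) @^-1` [set y | y <= c]) //.
apply: preimage_closed (@closed_le R c) => x _; exact: enormB_continuous.
Qed.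

Lemma convex_combB u x y t :
  t *: x + (1 - t) *: y - u = t *: (x - u) + (1 - t) *: (y - u).
Proof. by apply/rowP => i; rewrite !mxE; ring. Qed.

Lemma convex_eball u c : convex_set (eball u c).
Proof.
move=> x y t; rewrite !inE /eball /= => xc yc.
have -> : conv t x y - u = t%:num *: (x - u) + (1 - t%:num) *: (y - u).
  exact: convex_combB.
have t0 : 0 <= t%:num by [].
have t1 : t%:num <= 1 by [].
apply: le_trans (enormD _ _) _; rewrite !enormZ !ger0_norm ?subr_ge0 //.
nra.
Qed.

End euclidean.

(** * Minimisers of lower semicontinuous functions on compact sets *)

Section lower_semicontinuity.

(* The filter of sublevel sets [{x in K | f x <= f y}] clusters at a minimiser *)
Lemma compact_lsc_min {T : topologicalType} {R : realType}
    (f : T -> \bar R) (K : set T) :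
  compact K -> K !=set0 -> (forall x, K x -> f x != -oo%E) ->
  (forall x a, K x -> (a%:E < f x)%E ->
    \forall y \near x, K y -> (a%:E < f y)%E) ->
  exists2 p, K p & forall y, K y -> (f p <= f y)%E.
Proof.
move=> cK [x0 Kx0] fNy lscf.
pose B y := [set x | K x /\ (f x <= f y)%E].
have FB : ProperFilter (filter_from K B).
  apply: filter_from_proper => [|y Ky]; last by exists y.
  apply: filter_from_filter => [|y z Ky Kz]; first by exists x0.
  have [yz|/ltW zy] := leP (f y) (f z).
    by exists y => // x [Kx xy]; do !split => //; exact: le_trans yz.
  by exists z => // x [Kx xz]; do !split => //; exact: le_trans zy.
have [|p [Kp clp]] := cK _ FB; first by exists x0 => // x [].
exists p => // y Ky; rewrite leNgt; apply/negP => ltyp.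
have [r yr] : exists r, f y = r%:E.
  by case: (f y) (fNy y Ky) ltyp => [r||] // _; [exists r|case: (f p)].
rewrite yr in ltyp.
(* The neighbourhood of the cluster point [p] where [f > f y] would have to meet the sublevel set of
   [y]. *)
have [] := clp (B y) [set x | K x -> (r%:E < f x)%E].
- by exists y.
- exact: lscf.
- by move=> x [[Kx xy]] /(_ Kx); rewrite ltNge -yr xy.
Qed.

End lower_semicontinuity.

(** * Frechet subgradients and local minorants *)

Section subdifferentials.
Context {R : realType} {n : nat}.
Implicit Types (phi psi : 'rV[R]_n -> \bar R) (u v w x y : 'rV[R]_n).
Implicit Types (a b c e : R).

(** Proximal subgradients are Frechet subgradients: the difference quotient is at least
    [- c |x - u|], which tends to 0. The sign of [c] is free, hence [|c|] below. *)
Lemma frechet_subdiffI phi u v a c : phi u = a%:E ->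
  (\forall x \near u,
     ((a + dot v (x - u) - c * enorm (x - u) ^+ 2)%:E <= phi x)%E) ->
  frechet_subdiff phi u v.
Proof.
move=> phiu nearu; split; first by rewrite /dom /= phiu ltry.
rewrite limf_einfE; apply/lee_addgt0Pr => e e0; rewrite addeC -leeBlDl // sub0e.
pose A := [set x | [/\ x != u, `|c| * enorm (x - u) <= e &
  ((a + dot v (x - u) - c * enorm (x - u) ^+ 2)%:E <= phi x)%E]].
have uA : u^' A.
  have d0 : 0 < e / (`|c| + 1) by rewrite divr_gt0 // ltr_pwDr.
  rewrite /dnbhs /within /=; near=> x => xu; split => //; last by near: x.
  have : enorm (x - u) < e / (`|c| + 1) by near: x; exact: near_enorm.
  rewrite ltr_pdivlMr ?ltr_pwDr //; have := enorm_ge0 (x - u); nra.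
apply: le_ereal_sup_tmp; exists (ereal_inf
  ((fun x => (phi x - phi u - (dot v (x - u))%:E) *
     ((enorm (x - u))^-1)%:E)%E @` A)); first by exists A.
apply: le_ereal_inf_tmp => _ [x [xu xc xphi] <-].
have xu0 : 0 < enorm (x - u) by rewrite enorm_gt0 // subr_eq0.
rewrite phiu; case: (phi x) xphi => [b||] //; last first.
  by move=> _; rewrite /= gt0_mulye ?lte_fin ?invr_gt0 // leey.
rewrite lee_fin => xb; rewrite /= -!EFinB -EFinM lee_fin ler_pdivlMr //.
have := ler_norm c; nra.
Unshelve. all: by end_near. Qed.

(** The liminf is a supremum of infima over punctured neighbourhoods, so one of these infima exceeds
    [- e]; at [x = u] both sides equal [a]. *)
Lemma frechet_subdiffE phi u v a e :
  (forall x, phi x != -oo%E) -> phi u = a%:E -> frechet_subdiff phi u v ->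
  0 < e ->
  \forall x \near u,
    ((a + dot v (x - u) - e * enorm (x - u))%:E <= phi x)%E.
Proof.
move=> phiNy phiu [_]; rewrite limf_einfE => sup_ge0 e0.
have : ((- e)%:E < 0 :> \bar R)%E by rewrite lte_fin oppr_lt0.
move=> /lt_le_trans /(_ sup_ge0) /ereal_sup_gt[_ [A uA <-]] ltA.
rewrite /dnbhs /within /= in uA; near=> x.
have [->|xu] := eqVneq x u.
  by rewrite subrr dot0r enorm0 phiu !mulr0 addr0 subr0.
have Ax : A x by move: xu; near: x.
have /(lt_le_trans ltA) : (ereal_inf
  ((fun x => (phi x - phi u - (dot v (x - u))%:E) *
     ((enorm (x - u))^-1)%:E)%E @` A) <= (phi x - phi u - (dot v (x - u))%:E) *
     ((enorm (x - u))^-1)%:E)%E.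
  by apply: ge_ereal_inf; eexists; [exists x|].
have xu0 : 0 < enorm (x - u) by rewrite enorm_gt0 // subr_eq0.
rewrite phiu; case: (phi x) (phiNy x) => [b||] // _; last by rewrite leey.
rewrite -!EFinB -EFinM lte_fin ltr_pdivlMr // lee_fin; lra.
Unshelve. all: by end_near. Qed.

Lemma sub_frechet_limiting phi u :
  frechet_subdiff phi u `<=` limiting_subdiff phi u.
Proof.
move=> v uv; split; first by case: uv.
by exists (fun=> u), (fun=> v); split => //; exact: cvg_cst.
Qed.

End subdifferentials.

(** * Subgradients of strongly convex functions *)

Section strong_convexity.
Context {R : realType} {n : nat}.
Implicit Types (phi psi : 'rV[R]_n -> \bar R) (u v w x y : 'rV[R]_n).
Implicit Types (a b c e t sigma : R) (U : set 'rV[R]_n).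

Lemma dom_fin phi u : (forall x, phi x != -oo%E) -> dom phi u ->
  exists a, phi u = a%:E.
Proof. by rewrite /dom /= => /(_ u); case: (phi u) => [r||] //; exists r. Qed.

Lemma dot_convex_comb x u t :
  dot (t *: x + (1 - t) *: u) (t *: x + (1 - t) *: u) =
  t * dot x x + (1 - t) * dot u u - t * (1 - t) * dot (x - u) (x - u).
Proof. by rewrite !dotE (dotC u x); ring. Qed.

(** At [y = t x + (1 - t) u] the Frechet lower bound meets the upper bound from strong convexity;
    after division by [t] the error vanishes with [t] and [e']. *)
Lemma frechet_strongly_convex_le psi U sigma u v x a b :
  (forall y, psi y != -oo%E) -> 0 < sigma ->
  strongly_convex_on U sigma psi -> U u -> U x ->
  psi u = a%:E -> psi x = b%:E -> frechet_subdiff psi u v ->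
  a + dot v (x - u) + sigma / 2 * enorm (x - u) ^+ 2 <= b.
Proof.
move=> psiNy sigma0 convU Uu Ux psiu psix uv; apply/ler_addgt0Pr => e e0.
set d := x - u; have d0 := enorm_ge0 d.
pose e' := e / 2 / (enorm d + 1).
have e'0 : 0 < e' by rewrite divr_gt0 ?divr_gt0 // ltr_wpDl.
have [c c0 near_u] := nbhs_enormP _ _
  (frechet_subdiffE _ _ _ _ _ psiNy psiu uv e'0).
have sd1 : 0 < sigma * enorm d ^+ 2 + 1.
  by rewrite ltr_wpDl // mulr_ge0 ?sqr_ge0 ?ltW.
(* This [t] keeps [y] within [c] of [u] and makes [t sigma / 2 |d|^2] at most [e / 2]; the other
   error [e' |d|] is at most [e / 2] by the choice of [e']. *)
have [t [t0 t1 tc te]] : exists t, [/\ 0 < t, t <= 1,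
    t * (enorm d + 1) <= c & t * (sigma * enorm d ^+ 2 + 1) <= e].
  exists (Num.min 1 (Num.min (c / (enorm d + 1))
                             (e / (sigma * enorm d ^+ 2 + 1)))); split.
  - by rewrite !lt_min ltr01 !divr_gt0 // ltr_wpDl.
  - by rewrite ge_min lexx.
  - by rewrite -ler_pdivlMr ?ltr_wpDl // !ge_min lexx orbT.
  - by rewrite -ler_pdivlMr // !ge_min lexx !orbT.
have e'E : e' * (enorm d + 1) = e / 2 by rewrite divfK // gt_eqF // ltr_wpDl.
pose y := t *: x + (1 - t) *: u.
have yuE : y - u = t *: d.
  by apply/rowP => i; rewrite /y /d !mxE; ring.
have yu : eball u c y.
  rewrite /eball /= yuE enormZ gtr0_norm //; apply: le_trans tc.
  by rewrite ler_pM2l // lerDl ler01.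
have := near_u _ yu; rewrite /= yuE dotZr enormZ gtr0_norm //.
have := convU x u t Ux Uu; rewrite (ltW t0) t1 => /(_ isT) /=.
rewrite -/y psiu psix.
case: (psi y) (psiNy y) => [p||] //.
rewrite -!EFinB -!EFinM -EFinD !lee_fin !enorm_sqr dot_convex_comb -/d => _.
rewrite -(enorm_sqr d) => h1 h2.
have h : t * (a + dot v d + sigma / 2 * enorm d ^+ 2) <=
   t * (b + e' * enorm d + t * sigma / 2 * enorm d ^+ 2) by lra.
rewrite ler_pM2l // in h; nra.
Qed.

(** The Frechet inequality passes to the limit, because [psi (u_ k)] is eventually finite and
    converges to [psi u]. *)
Lemma limiting_strongly_convex_le psi U sigma u v x :
  (forall y, psi y != -oo%E) -> 0 < sigma ->
  strongly_convex_on U sigma psi -> nbhs u U -> U x ->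
  limiting_subdiff psi u v ->
  (psi u + (dot v (x - u) + sigma / 2 * enorm (x - u) ^+ 2)%:E <= psi x)%E.
Proof.
move=> psiNy sigma0 convU uU Ux [domu [u_ [v_ [u_u psi_u uv_ v_v]]]].
have [a psiu] := dom_fin _ _ psiNy domu.
case psix : (psi x) (psiNy x) => [b||] // _; last by rewrite leey.
rewrite psiu -EFinD lee_fin addrA; rewrite psiu in psi_u.
move/fine_cvgP : psi_u => [fin_u psi_u].
have xu_ : x - u_ k @[k --> \oo] --> x - u by apply: cvgB => //; exact: cvg_cst.
have cvg_l : fine (psi (u_ k)) + dot (v_ k) (x - u_ k)
    + sigma / 2 * enorm (x - u_ k) ^+ 2 @[k --> \oo] -->
    a + dot v (x - u) + sigma / 2 * enorm (x - u) ^+ 2.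
  apply: cvgD; first by apply: cvgD => //; exact: cvg_dot.
  apply: cvgM; first exact: cvg_cst.
  by apply: cvgM; exact: cvg_enorm.
apply: (cvgr_to_le cvg_l).
have Uu_ := u_u _ uU; near=> k.
apply: (@frechet_strongly_convex_le psi U sigma (u_ k) (v_ k) x) => //.
- by near: k.
- by rewrite fineK //; near: k.
Unshelve. all: by end_near. Qed.

Lemma strongly_convex_subdiff_monotone psi U sigma u1 v1 u2 v2 :
  (forall y, psi y != -oo%E) -> 0 < sigma ->
  strongly_convex_on U sigma psi -> nbhs u1 U -> nbhs u2 U ->
  limiting_subdiff psi u1 v1 -> limiting_subdiff psi u2 v2 ->
  sigma * enorm (u1 - u2) ^+ 2 <= dot (v1 - v2) (u1 - u2).
Proof.
move=> psiNy sigma0 convU Uu1 Uu2 uv1 uv2.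
have := limiting_strongly_convex_le _ _ _ _ _ _ psiNy sigma0 convU Uu1
  (nbhs_singleton Uu2) uv1.
have := limiting_strongly_convex_le _ _ _ _ _ _ psiNy sigma0 convU Uu2
  (nbhs_singleton Uu1) uv2.
have [a1 ->] := dom_fin _ _ psiNy uv1.1.
have [a2 ->] := dom_fin _ _ psiNy uv2.1.
by rewrite -!EFinD !lee_fin (enormB u2) !dotE; lra.
Qed.

End strong_convexity.

Lemma variationally_strongly_convex_monotone {R : realType} {n : nat}
    (phi : 'rV[R]_n -> \bar R) (xb : 'rV[R]_n) (sigma : R) :
  (forall x, phi x != -oo%E) -> 0 < sigma ->
  limiting_subdiff phi xb 0 -> subdiff_continuous phi xb 0 ->
  variationally_strongly_convex phi xb 0 sigma ->
  locally_strongly_monotone (limiting_subdiff phi) xb 0 sigma.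
Proof.
move=> phiNy sigma0 phi0 phi_cont [_ _ [U [V [psi [eps []]]]]].
move=> [Uxb _ V0 _] [[psiNy _] _ _ convU] eps0 gphE _.
split=> //; have [delta [delta0 phi_near]] := phi_cont eps eps0.
(* The interior makes [U] a neighbourhood of each base point; [delta] comes from subdifferential
   continuity and gives [phi u < phi xb + eps]. *)
exists ((U^° `&` eball xb delta) `*` (V `&` eball 0 delta)); split.
  exists (U^° `&` eball xb delta, V `&` eball 0 delta) => //; split.
    by apply: filterI; [exact: nbhs_interior|exact: nbhs_eball].
  by apply: filterI => //; exact: nbhs_eball.
have gph_psi u v : (gph (limiting_subdiff phi) `&`
      ((U^° `&` eball xb delta) `*` (V `&` eball 0 delta))) (u, v) ->
    nbhs u U /\ limiting_subdiff psi u v.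
  move=> [uv [[/= Uu udelta] [Vv vdelta]]]; split => //.
  suff : ((U `*` V) `&` gph (limiting_subdiff psi)) (u, v) by case.
  rewrite -gphE; do !split => //=; first exact: nbhs_singleton.
  have := phi_near u v uv udelta vdelta.
  have [a ->] := dom_fin _ _ phiNy phi0.1; case: (phi u) => [r||] //.
  by rewrite -EFinB lte_fin /= => /ltr_normlW; rewrite -EFinD lte_fin; lra.
move=> u1 v1 u2 v2 /gph_psi[Uu1 uv1] /gph_psi[Uu2 uv2].
exact: (strongly_convex_subdiff_monotone _ _ _ _ _ _ _
  psiNy sigma0 convU Uu1 Uu2 uv1 uv2).
Qed.

(** * From strong monotonicity to tilt stability *)

Section minimizers.
Context {R : realType} {n : nat}.
Implicit Types (phi : 'rV[R]_n -> \bar R) (u v w x y p xb : 'rV[R]_n).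
Implicit Types (a b c e t r sigma delta : R).

Lemma near_eball u p c : enorm (p - u) < c -> \forall x \near p, eball u c x.
Proof.
move=> /(cvgr_lt _ (enormB_continuous u p)); apply: filterS => x; exact: ltW.
Qed.

Lemma lower_semicontinuousD_cont phi (h : 'rV[R]_n -> R) :
  lower_semicontinuous phi -> continuous h ->
  lower_semicontinuous (fun x => phi x + (h x)%:E)%E.
Proof.
move=> lsc_phi hC x a ax.
(* The level [m] splits the slack: near [x], [phi > m] and [h > a - m]. *)
have [m am mx] : exists2 m, a - h x < m & (m%:E < phi x)%E.
  move: ax; case: (phi x) => [b||] //=.
    rewrite -EFinD lte_fin => ab; exists ((a - h x + b) / 2); first lra.
    by rewrite lte_fin; lra.
  by move=> _; exists (a - h x + 1); [lra|rewrite ltry].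
have [V xV Vm] := lsc_phi x m mx.
have hx : \forall y \near x, a - m < h y by apply: (cvgr_gt _ (hC x)); lra.
exists (V `&` [set y | a - m < h y]); first exact: filterI.
move=> y [/Vm my /= hy]; move: my; case: (phi y) => [b||] //=.
  by rewrite -EFinD !lte_fin; lra.
by move=> _; rewrite ltry.
Qed.

Lemma argmin_eball phi (h : 'rV[R]_n -> R) xb delta :
  (forall x, phi x != -oo%E) -> lower_semicontinuous phi -> continuous h ->
  0 <= delta ->
  exists p, argmin (fun x => phi x + (h x)%:E)%E (eball xb delta) p.
Proof.
move=> phiNy lsc_phi hC delta0.
suff [p pd pmin] : exists2 p, eball xb delta p & forall y, eball xb delta y ->
    (phi p + (h p)%:E <= phi y + (h y)%:E)%E by exists p.
apply: (compact_lsc_min (fun x => phi x + (h x)%:E)%E).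
- exact: compact_eball.
- by exists xb; rewrite /eball /= subrr enorm0.
- by move=> x _; case: (phi x) (phiNy x).
- move=> x a _ ax.
  have [V xV Va] := lower_semicontinuousD_cont _ _ lsc_phi hC x a ax.
  by apply: filterS xV => y /Va.
Qed.

Lemma dot_continuous v : continuous (fun x => dot v x).
Proof.
move=> x; apply: (@cvg_dot _ _ _ (nbhs x) _ (cst v) id v x).
  exact: cvg_cst.
exact: cvg_id.
Qed.

(* [v = 0] yields proximal points, and [r = 0] Fermat's rule for the tilted
   function. *)
Lemma interior_argmin_subdiff phi xb delta v w r p b :
  phi p = b%:E ->
  argmin (fun x => phi x + (r * enorm (x - w) ^+ 2 - dot v x)%:E)%E
    (eball xb delta) p ->
  enorm (p - xb) < delta ->
  limiting_subdiff phi p (v + (2 * r) *: (w - p)).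
Proof.
move=> phip [_ pmin] pint; apply: sub_frechet_limiting.
apply: (frechet_subdiffI _ _ _ b r phip).
have := near_eball _ _ _ pint; apply: filterS => x /pmin; rewrite phip.
case: (phi x) => [c||] /=; [|by move=> _; rewrite leey|];
  last by rewrite -EFinD leeNy_eq.
(* Expanding the penalty around [p] turns minimality into a proximal inequality with constant
   [r]. *)
rewrite -!EFinD !lee_fin; suff -> : r * enorm (x - w) ^+ 2 =
  r * enorm (p - w) ^+ 2 - dot ((2 * r) *: (w - p)) (x - p)
  + r * enorm (x - p) ^+ 2 by rewrite !dotE; lra.
rewrite !enorm_sqr !dotE (dotC x w) (dotC x p) (dotC p w); ring.
Qed.

Lemma locally_strongly_monotone_eball
    (T : 'rV[R]_n -> set 'rV[R]_n) xb sigma :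
  locally_strongly_monotone T xb 0 sigma ->
  exists2 c, 0 < c & forall u1 v1 u2 v2,
    T u1 v1 -> enorm (u1 - xb) <= c -> enorm v1 <= c ->
    T u2 v2 -> enorm (u2 - xb) <= c -> enorm v2 <= c ->
    sigma * enorm (u1 - u2) ^+ 2 <= dot (v1 - v2) (u1 - u2).
Proof.
move=> [_ [W [[[A B] /= [Axb B0] ABW] monoW]]].
have [c1 c10 cA] := nbhs_enormP _ _ Axb.
have [c2 c20 cB] := nbhs_enormP _ _ B0.
exists (Num.min c1 c2); first by rewrite lt_min c10.
move=> u1 v1 u2 v2; rewrite !le_min => Tuv1 /andP[u1c _] /andP[_ v1c].
move=> Tuv2 /andP[u2c _] /andP[_ v2c].
apply: monoW; split => //; apply: ABW; split => /=.
- exact: cA.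
- by apply: cB; rewrite /eball /= subr0.
- exact: cA.
- by apply: cB; rewrite /eball /= subr0.
Qed.

End minimizers.

(** * Quadratic growth by iterating a bound on the Moreau envelope *)

Section monotone_growth.
Context {R : realType} {n : nat}.
Variables (phi : 'rV[R]_n -> \bar R) (xb : 'rV[R]_n) (sigma r a delta : R).
Hypotheses (phiNy : forall x, phi x != -oo%E).
Hypotheses (lsc_phi : lower_semicontinuous phi) (phi_xb : phi xb = a%:E).
Hypotheses (sigma_gt0 : 0 < sigma) (r_gt0 : 0 < r) (delta_gt0 : 0 < delta).
Hypothesis prox_xb : forall x, eball xb delta x ->
  ((a - r / 2 * enorm (x - xb) ^+ 2)%:E <= phi x)%E.
Hypothesis mono_xb : forall u v, limiting_subdiff phi u v ->
  enorm (u - xb) <= delta -> enorm v <= delta ->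
  sigma * enorm (u - xb) ^+ 2 <= dot v (u - xb).

(** Monotonicity makes the proximal map of parameter [1 / (2 r)] shrink the distance to [xb] by the
    factor [1 - s]. *)
Let s := sigma / (2 * r + sigma).
(** For [w] this close to [xb], the bound [|p - xb| <= 4 |w - xb|] makes the proximal point [p]
    interior, and its subgradient [2 r (w - p)] has norm at most [delta]. *)
Let delta' := Num.min (delta / 5) (delta / (10 * r)).

Let s_gt0 : 0 < s.
Proof. by rewrite divr_gt0 // addr_gt0 ?mulr_gt0. Qed.

Let s_lt1 : s < 1.
Proof.
by rewrite ltr_pdivrMr ?addr_gt0 ?mulr_gt0 // mul1r ltrDr mulr_gt0.
Qed.

(* A lower bound [a + c |w - xb|^2] for the Moreau envelope of [phi]. *)
Let envelope_ge (c : R) := forall w y, eball xb delta' w -> eball xb delta y ->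
  ((a + c * enorm (w - xb) ^+ 2 - r * enorm (y - w) ^+ 2)%:E <= phi y)%E.

(** With [q = y - xb] and [e = w - xb], this is [|q|^2 <= 2 |e|^2 + 2 |q - e|^2] applied to the
    prox-regularity bound. *)
Let envelope_geN : envelope_ge (- r).
Proof.
move: (sigma_gt0) (r_gt0) (delta_gt0) => sigma0 r0 delta0.
move=> w y _ /prox_xb; apply: le_trans; rewrite lee_fin.
have -> : y - w = (y - xb) - (w - xb) by rewrite opprB addrA subrK.
move: (y - xb) (w - xb) => q e.
have := sqr_ge0 (enorm (1 *: q - 2 *: e)).
by move=> /(mulr_ge0 (ltW r0)); rewrite enorm_combB_sqr enormB_sqr; lra.
Qed.

(* Monotonicity between [(xb, 0)] and [(p, 2 r (w - p))] reads
   [sigma |p - xb|^2 <= 2 r <w - p, p - xb>]; completing the square gives the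
   last clause. *)
Let prox_point w : eball xb delta' w -> exists p b,
  [/\ phi p = b%:E, eball xb delta p,
      forall y, eball xb delta y ->
        ((b + r * enorm (p - w) ^+ 2 - r * enorm (y - w) ^+ 2)%:E <= phi y)%E &
      s * enorm (w - xb) ^+ 2 <= dot (w - p) (w - xb)].
Proof.
move: (sigma_gt0) (r_gt0) (delta_gt0) => sigma0 r0 delta0.
rewrite /eball /= le_min => /andP[wd1 wd2].
have {}wd1 : 5 * enorm (w - xb) <= delta by rewrite mulrC -ler_pdivlMr.
have {}wd2 : 10 * r * enorm (w - xb) <= delta.
  by rewrite mulrC -ler_pdivlMr ?mulr_gt0.
have hC : continuous (fun x : 'rV[R]_n => r * enorm (x - w) ^+ 2 - dot 0 x).
  move=> x; have e := enormB_continuous w x.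
  exact: (cvgB (cvgM (cvg_cst r) (cvgM e e)) (dot_continuous 0 x)).
have [p pmin] := argmin_eball phi _ xb delta phiNy lsc_phi hC (ltW delta0).
have [pd pmin'] := pmin; have [b phip] : exists b, phi p = b%:E.
  apply: dom_fin phiNy _; rewrite /dom /=.
  have /pmin' : eball xb delta xb by rewrite /eball /= subrr enorm0 ltW.
  rewrite phi_xb; case: (phi p) (phiNy p) => [c||] //= _.
  by move=> _; rewrite ltry.
have pmin_real y : eball xb delta y ->
    ((b + r * enorm (p - w) ^+ 2 - r * enorm (y - w) ^+ 2)%:E <= phi y)%E.
  move=> /pmin'; rewrite phip !dot0l.
  case: (phi y) (phiNy y) => [c||] //= _; last by move=> _; rewrite leey.
  by rewrite -!EFinD !lee_fin; lra.
exists p, b; split => //.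
set e := w - xb in wd1 wd2 *; pose q := p - xb.
have wpE : w - p = e - q by rewrite /e /q opprB addrA subrK.
have qe : enorm q <= 4 * enorm e.
  (* Compares the minimum with the value at [xb], bounding [phi p] below by prox-regularity. *)
  have : enorm q ^+ 2 <= 4 * dot q e.
    have := prox_xb _ pd; rewrite phip lee_fin => h1.
    have : eball xb delta xb by rewrite /eball /= subrr enorm0 ltW.
    move=> /pmin_real; rewrite phi_xb lee_fin (enormB p) wpE (enormB xb).
    rewrite -/e; rewrite -/q in h1.
    rewrite (enormB_sqr e q) (dotC e q) => h2; rewrite -(ler_pM2l r0); lra.
  have := dot_le_enorm q e; have := enorm_ge0 q; have := enorm_ge0 e.
  have [->|q0] := eqVneq (enorm q) 0; first by lra.
  move=> e_ge0 q_ge0 h1 h2.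
  have qgt0 : 0 < enorm q by rewrite lt_neqAle eq_sym q0.
  by rewrite -(ler_pM2l qgt0); lra.
have e_ge0 := enorm_ge0 e.
have q_lt : enorm (p - xb) < delta.
  by apply: le_lt_trans qe _; lra.
have := interior_argmin_subdiff _ _ _ _ _ _ _ _ phip pmin q_lt.
rewrite add0r => /mono_xb /(_ (ltW q_lt)).
have -> : enorm ((2 * r) *: (w - p)) <= delta.
  rewrite enormZ gtr0_norm ?mulr_gt0 // wpE.
  have h : enorm (e - q) <= 5 * enorm e.
    by have := enormD e (- q); rewrite enormN; lra.
  by have := ler_wpM2l (ltW r0) h; lra.
move=> /(_ isT); rewrite wpE -/q => mono_q.
(* Together with [(2 r + sigma) |q|^2 <= 2 r <q, e>], this square gives
   [(2 r + sigma) <q, e> <= 2 r |e|^2]. *)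
have sq := sqr_ge0 (enorm ((2 * r + sigma) *: q - (2 * r) *: e)).
rewrite (enorm_combB_sqr _ q _ e) in sq.
have rs : 0 < 2 * r + sigma by lra.
have sE : (2 * r + sigma) * s = sigma by rewrite mulrC divfK // gt_eqF.
rewrite -(ler_pM2l rs) mulrA sE.
move: sq mono_q; rewrite dotZl !(dotDl e) !(dotNl q) (dotC e q) -!enorm_sqr.
move: (enorm q ^+ 2) (dot q e) (enorm e ^+ 2) => Q B E sq mono_q.
by rewrite -(ler_pM2l r0); nra.
Qed.

(* Compares [w] with the point [(1 - s) w + s xb] closer to [xb]; iterating
   from [- r], the constant tends to its fixed point [r s / (2 - s) > 0]. *)
Let envelope_ge_step c :
  envelope_ge c -> envelope_ge (c * (1 - s) ^+ 2 + r * s ^+ 2).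
Proof.
move: (sigma_gt0) (r_gt0) (delta_gt0) => sigma0 r0 delta0.
move=> envc w y wd yd.
have [p [b [phip pd pmin swp]]] := prox_point w wd.
apply: le_trans (pmin y yd); rewrite lee_fin.
have s0 := s_gt0; have s1 := s_lt1.
have wtE : (1 - s) *: w + s *: xb - xb = (1 - s) *: (w - xb).
  by apply/rowP => i; rewrite !mxE; ring.
have wt : eball xb delta' ((1 - s) *: w + s *: xb).
  rewrite /eball /= wtE enormZ gtr0_norm ?subr_gt0 //; apply: le_trans wd.
  by rewrite ler_piMl ?enorm_ge0 // gerBl ltW.
have := envc _ p wt pd; rewrite phip lee_fin wtE enormZ gtr0_norm ?subr_gt0 //.
set e := w - xb in swp *.
(* In the expanded square, the cross term is at least [2 r s^2 |e|^2]; subtracting [r s^2 |e|^2]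
   leaves the gain [r s^2 |e|^2]. *)
have -> : p - ((1 - s) *: w + s *: xb) = s *: e - 1 *: (w - p).
  by apply/rowP => i; rewrite /e !mxE; ring.
rewrite (enormB p w) (enorm_combB_sqr s e 1) exprMn (dotC e).
have rs : 0 <= 2 * r * s by rewrite ltW // (mulr_gt0 (mulr_gt0 _ r0) s0).
by have := ler_wpM2l rs swp; lra.
Qed.

Lemma monotone_quadratic_growth : exists c delta1,
  [/\ 0 < c, 0 < delta1 & forall x, eball xb delta1 x ->
    ((a + c * enorm (x - xb) ^+ 2)%:E <= phi x)%E].
Proof.
move: (sigma_gt0) (r_gt0) (delta_gt0) => sigma0 r0 delta0.
have s0 := s_gt0; have s1 := s_lt1.
have s2 : 0 < 2 - s by lra.
have [c c0 cE] : exists2 c, 0 < c & c * (2 - s) = r * s.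
  exists (r * s / (2 - s)); first by rewrite divr_gt0 // (mulr_gt0 r0).
  by rewrite divfK // gt_eqF.
have cF : c * (1 - s) ^+ 2 + r * s ^+ 2 = c.
  have -> : c * (1 - s) ^+ 2 = c - s * (c * (2 - s)) by ring.
  by rewrite cE; ring.
(* Closed form of the iteration: the gap to the fixed point [c] starts at [c + r] and is multiplied
   by [(1 - s)^2] each time. *)
have envk k : envelope_ge (c - (c + r) * ((1 - s) ^+ 2) ^+ k).
  elim: k => [|k /envelope_ge_step].
    by rewrite expr0 mulr1 opprD addNKr; exact: envelope_geN.
  suff -> : c - (c + r) * ((1 - s) ^+ 2) ^+ k.+1 =
    (c - (c + r) * ((1 - s) ^+ 2) ^+ k) * (1 - s) ^+ 2 + r * s ^+ 2 by [].
  by rewrite exprS -{1}cF; ring.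
exists (c / 2), delta'; split.
- by rewrite divr_gt0.
- by rewrite lt_min !divr_gt0 ?mulr_gt0.
have : ((1 - s) ^+ 2) ^+ k @[k --> \oo] --> (0 : R).
  by apply: cvg_expr; rewrite ger0_norm ?sqr_ge0 //; nra.
(* Once the gap is below [c / 2], taking [w = y = x] removes the penalty term. *)
have d0 : 0 < c / 2 / (c + r) by rewrite !divr_gt0 // addr_gt0.
move=> /cvgr_lt /(_ _ d0) [k _ /(_ k (leqnn k))] /=.
rewrite ltr_pdivlMr ?addr_gt0 // => zk x xd.
have xd' : eball xb delta x.
  apply: le_trans xd _; rewrite ge_min; apply/orP; left; lra.
apply: le_trans (envk k x x xd xd'); rewrite lee_fin subrr enorm0.
have := sqr_ge0 (enorm (x - xb)); nra.
Qed.

End monotone_growth.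

(** * Tilted minimisers under quadratic growth and monotonicity *)

Section monotone_tilt.
Context {R : realType} {n : nat}.
Implicit Types (phi : 'rV[R]_n -> \bar R) (u v w x y p xb : 'rV[R]_n).

Lemma tilt_argmin_exists phi xb gamma v :
  (forall x, phi x != -oo%E) -> lower_semicontinuous phi -> 0 <= gamma ->
  tilt_argmin phi xb gamma v !=set0.
Proof.
move=> phiNy lsc_phi gamma0.
have vC : continuous (fun x => - dot v x).
  by move=> x; exact: (cvgN (dot_continuous v x)).
have [p [pd pmin]] := argmin_eball phi _ xb gamma phiNy lsc_phi vC gamma0.
by exists p; split => // y /pmin; rewrite !EFinN.
Qed.

Lemma tilt_argmin_fin phi xb gamma v u a :
  (forall x, phi x != -oo%E) -> 0 <= gamma -> phi xb = a%:E ->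
  tilt_argmin phi xb gamma v u ->
  exists2 b, phi u = b%:E & b <= a + dot v (u - xb).
Proof.
move=> phiNy gamma0 phi_xb [_ /(_ xb)]; rewrite /eball /= subrr enorm0.
move=> /(_ gamma0); rewrite phi_xb; case: (phi u) (phiNy u) => [b||] // _.
by rewrite -!EFinB lee_fin => h; exists b => //; rewrite !dotE; lra.
Qed.

Lemma tilt_argmin_subdiff phi xb gamma v u b : phi u = b%:E ->
  tilt_argmin phi xb gamma v u -> enorm (u - xb) < gamma ->
  limiting_subdiff phi u v.
Proof.
move=> phiu [ud umin] uint; rewrite -[v]addr0 -(scale0r (0 - u)) -(mulr0 2).
apply: (interior_argmin_subdiff _ xb gamma v 0 0 _ _ phiu) uint.
by split => // y /umin; rewrite !mul0r !sub0r !EFinN.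
Qed.

Lemma monotone_tilt_stable phi xb (sigma : R) :
  (forall x, phi x != -oo%E) -> dom phi xb -> 0 < sigma ->
  limiting_subdiff phi xb 0 -> prox_regular phi xb 0 ->
  locally_strongly_monotone (limiting_subdiff phi) xb 0 sigma ->
  tilt_stable_local_minimizer phi xb sigma^-1.
Proof.
move=> phiNy xb_dom sigma0 phi0 [lsc_phi _ [eps [r [eps0 r_ge0 prox]]]].
move=> /locally_strongly_monotone_eball[w w0 mono].
have xbb c : 0 < c -> enorm (xb - xb) <= c by rewrite subrr enorm0 => /ltW.
have v0b c : 0 < c -> enorm (0 : 'rV[R]_n) <= c by rewrite enorm0 => /ltW.
have [a phi_xb] := dom_fin _ _ phiNy xb_dom.
have [c [delta [c0 delta0 growth]]] : exists c delta,
    [/\ 0 < c, 0 < delta & forall x, eball xb delta x ->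
      ((a + c * enorm (x - xb) ^+ 2)%:E <= phi x)%E].
  (* The growth lemma wants a positive constant, so [r] is enlarged to [r + 1]. *)
  have r1 : 0 < r + 1 by rewrite ltr_wpDl.
  have d0 : 0 < Num.min eps w by rewrite lt_min eps0.
  apply: (monotone_quadratic_growth _ _ _ _ _ _
    phiNy lsc_phi phi_xb sigma0 r1 d0).
    move=> x; rewrite /eball /= le_min => /andP[xeps _].
    have := prox x xb 0 xeps phi0 (xbb _ eps0); rewrite /eball /= subrr.
    move=> /(_ (v0b _ eps0)); rewrite phi_xb dot0l -EFinD lte_fin ltrDl.
    move=> /(_ eps0); rewrite -!EFinD; apply: le_trans; rewrite lee_fin.
    by have := sqr_ge0 (enorm (x - xb)); lra.
  move=> u v uv; rewrite !le_min => /andP[_ uw] /andP[_ vw].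
  by have := mono u v xb 0 uv uw vw phi0 (xbb _ w0) (v0b _ w0); rewrite subr0.
pose gamma := Num.min delta w.
have gamma0 : 0 < gamma by rewrite lt_min delta0.
(* Growth gives [c |u - xb| <= |v|] for a tilted minimiser [u]; with [|v| <= c gamma / 2] it is
   interior. *)
pose nu := Num.min w (c * gamma / 2).
have nu0 : 0 < nu by rewrite lt_min w0 !mulr_gt0.
have argmin_sub v u : enorm v <= nu -> tilt_argmin phi xb gamma v u ->
    enorm (u - xb) <= w /\ limiting_subdiff phi u v.
  rewrite le_min => /andP[vw vc] uv.
  have [b phiu bu] := tilt_argmin_fin _ _ _ _ _ _ phiNy (ltW gamma0) phi_xb uv.
  have ud : eball xb delta u.
    by case: uv => + _; rewrite /eball /= le_min => /andP[].
  have := growth u ud; rewrite phiu lee_fin => au.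
  have uxb : c * enorm (u - xb) <= enorm v.
    have [->|u0] := eqVneq (enorm (u - xb)) 0; first by rewrite mulr0 enorm_ge0.
    have u_gt0 : 0 < enorm (u - xb) by rewrite lt_neqAle eq_sym u0 enorm_ge0.
    by rewrite -(ler_pM2l u_gt0); have := dot_le_enorm v (u - xb); lra.
  split; first by case: uv => + _; rewrite /eball /= le_min => /andP[].
  apply: (tilt_argmin_subdiff _ _ _ _ _ _ phiu uv).
  by rewrite -(ltr_pM2l c0); have := mulr_gt0 c0 gamma0; lra.
have argmin_dist v1 v2 u1 u2 : enorm v1 <= nu -> enorm v2 <= nu ->
    tilt_argmin phi xb gamma v1 u1 -> tilt_argmin phi xb gamma v2 u2 ->
    enorm (u1 - u2) <= sigma^-1 * enorm (v1 - v2).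
  move=> v1nu v2nu /(argmin_sub _ _ v1nu)[u1w uv1].
  move=> /(argmin_sub _ _ v2nu)[u2w uv2].
  have v1w : enorm v1 <= w by apply: le_trans v1nu _; rewrite ge_min lexx.
  have v2w : enorm v2 <= w by apply: le_trans v2nu _; rewrite ge_min lexx.
  suff : sigma * enorm (u1 - u2) <= enorm (v1 - v2).
    by rewrite mulrC -ler_pdivlMr // mulrC.
  have h := mono _ _ _ _ uv1 u1w v1w uv2 u2w v2w.
  have [->|u0] := eqVneq (enorm (u1 - u2)) 0; first by rewrite mulr0 enorm_ge0.
  have u_gt0 : 0 < enorm (u1 - u2) by rewrite lt_neqAle eq_sym u0 enorm_ge0.
  rewrite -(ler_pM2l u_gt0); have := dot_le_enorm (v1 - v2) (u1 - u2); lra.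
(* Uniqueness is the Lipschitz estimate for two equal tilts. *)
have argmin1 v u : enorm v <= nu -> tilt_argmin phi xb gamma v u ->
    tilt_argmin phi xb gamma v = [set u].
  move=> vnu uv; apply/seteqP; split => [u' u'v|_ -> //] /=.
  apply/eqP; rewrite -subr_eq0; apply/eqP/enorm0_eq0/eqP.
  rewrite eq_le enorm_ge0 andbT.
  by have := argmin_dist v v u' u vnu vnu u'v uv; rewrite subrr enorm0 mulr0.
have /boolp.choice[m mE] v : exists u, tilt_argmin phi xb gamma v u.
  exact: (tilt_argmin_exists _ _ _ _ phiNy lsc_phi (ltW gamma0)).
split => //; exists gamma; split => //.
  apply: argmin1; first exact: v0b.
  split; first exact: xbb.
  move=> y; rewrite /eball /= le_min => /andP[yd _].
  rewrite phi_xb !dot0l !sube0; apply: le_trans (growth y yd).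
  by rewrite lee_fin lerDl mulr_ge0 ?sqr_ge0 // ltW.
exists (eball 0 nu), m; split; first exact: nbhs_eball.
  by move=> v; rewrite /eball /= subr0 => vnu; exact: argmin1.
move=> v1 v2; rewrite /eball /= !subr0 => v1nu v2nu.
exact: argmin_dist.
Qed.

End monotone_tilt.

(** * From tilt stability to variational strong convexity *)

Section contraction.
Context {R : realType} {n : nat}.
Implicit Types (u v w x y p : 'rV[R]_n).

(** By compactness [|T x - x|] has a minimiser [p]; as [T p] would lower it by the factor [q < 1],
    the minimum is 0. *)
Lemma eball_contraction_fixpoint (T : 'rV[R]_n -> 'rV[R]_n) u (c q : R) :
  0 <= c -> 0 <= q < 1 -> (forall x, eball u c x -> eball u c (T x)) ->
  (forall x y, eball u c x -> eball u c y ->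
    enorm (T x - T y) <= q * enorm (x - y)) ->
  exists2 p, eball u c p & T p = p.
Proof.
move=> c0 /andP[q0 q1] Tball Tlip.
have [|||x a xc|p pc pmin] := compact_lsc_min (fun x => (enorm (T x - x))%:E)
  (eball u c).
- exact: compact_eball.
- by exists u; rewrite /eball /= subrr enorm0.
- by [].
- rewrite lte_fin => ax.
  (* Moving [x] by less than half the gap changes [|T x - x|] by less than the gap, as [q < 1]. *)
  have d0 : 0 < (enorm (T x - x) - a) / 2 by rewrite divr_gt0 ?subr_gt0.
  apply: filterS (near_enorm x _ d0) => y yx yc; rewrite lte_fin.
  have := Tlip y x yc xc; have := enorm_triangle (T x) (T y) x.
  have := enorm_triangle (T y) y x; rewrite (enormB (T x) (T y)).
  by have := ler_wpM2r (enorm_ge0 (y - x)) (ltW q1); lra.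
exists p => //; apply/eqP; rewrite -subr_eq0; apply/eqP/enorm0_eq0/eqP.
rewrite eq_le enorm_ge0 andbT.
have q1' : 0 < 1 - q by rewrite subr_gt0.
rewrite -(pmulr_rle0 _ q1').
have := pmin _ (Tball _ pc); have := Tlip _ _ (Tball _ pc) pc.
by rewrite lee_fin; lra.
Qed.

(** Solutions are fixed points of [T v = v - t (v + r m v - w)]. Since [|d + r e|^2 <= L |d|^2] and
    [<d, d + r e> >= |d|^2] for increments [d], [e] of [v], [m v], the step [t = 1 / L] contracts
    squared distances by [1 - t]. *)
Lemma monotone_lipschitz_shift_surj (m : 'rV[R]_n -> 'rV[R]_n) (nu k r : R) :
  0 < nu -> 0 <= k -> 0 <= r ->
  (forall v1 v2, enorm v1 <= nu -> enorm v2 <= nu ->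
    0 <= dot (v1 - v2) (m v1 - m v2)) ->
  (forall v1 v2, enorm v1 <= nu -> enorm v2 <= nu ->
    enorm (m v1 - m v2) <= k * enorm (v1 - v2)) ->
  exists2 eta, 0 < eta & forall w, enorm (w - r *: m 0) <= eta ->
    exists2 v, enorm v <= nu & v + r *: m v = w.
Proof.
move=> nu0 k0 r0 mono lip.
have L1 : 1 <= 1 + 2 * (r * k) + (r * k) ^+ 2 by have := mulr_ge0 r0 k0; nra.
pose L := 1 + 2 * (r * k) + (r * k) ^+ 2.
have [t [t0 t1 tL]] : exists t, [/\ 0 < t, t <= 1 & t * L = 1].
  have L0 : 0 < L by rewrite (lt_le_trans ltr01).
  exists L^-1; split; [by rewrite invr_gt0|by rewrite invf_le1|].
  by rewrite mulVf // gt_eqF.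
pose q := Num.sqrt (1 - t).
have q2 : q ^+ 2 = 1 - t by rewrite sqr_sqrtr // subr_ge0.
have q0 : 0 <= q := sqrtr_ge0 _.
have q1 : q < 1 by nra.
(* [|T v| <= q nu + t |w - r m 0|], so this radius makes [T] preserve the ball. *)
exists ((1 - q) * nu); first by rewrite mulr_gt0 ?subr_gt0.
move=> w w_near; pose T v := v - t *: (v + r *: m v - w).
have Tlip v1 v2 : enorm v1 <= nu -> enorm v2 <= nu ->
    enorm (T v1 - T v2) <= q * enorm (v1 - v2).
  move=> v1nu v2nu; have d_ge0 := enorm_ge0 (v1 - v2).
  rewrite -(@ler_sqr R) ?nnegrE ?enorm_ge0 ?mulr_ge0 // exprMn q2.
  have := mono _ _ v1nu v2nu; have := lip _ _ v1nu v2nu.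
  have -> : T v1 - T v2 =
      1 *: (v1 - v2) - t *: (1 *: (v1 - v2) - - r *: (m v1 - m v2)).
    by apply/rowP => i; rewrite /T !mxE; ring.
  move: d_ge0; move: (v1 - v2) (m v1 - m v2) => d e d_ge0 e_le de_ge0.
  rewrite enorm_combB_sqr enorm_combB_sqr.
  have -> : dot d (1 *: d - - r *: e) = enorm d ^+ 2 + r * dot d e.
    by rewrite !dotE enorm_sqr; ring.
  have de_le : dot d e <= k * enorm d ^+ 2.
    have := dot_le_enorm d e; nra.
  have e_le2 : enorm e ^+ 2 <= k ^+ 2 * enorm d ^+ 2.
    by rewrite -exprMn ler_sqr ?nnegrE ?enorm_ge0 ?mulr_ge0.
  move: (dot d e) (enorm d ^+ 2) (enorm e ^+ 2) de_ge0 de_le e_le2 => B D E.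
  move=> B0 BD ED.
  have rB : 0 <= r * B by rewrite mulr_ge0.
  have h1 : r * B <= r * k * D by nra.
  have h2 : r ^+ 2 * E <= (r * k) ^+ 2 * D by nra.
  have h3 : t ^+ 2 * (D + 2 * (r * B) + r ^+ 2 * E) <= t ^+ 2 * (L * D).
    by rewrite ler_wpM2l ?sqr_ge0 // /L; lra.
  have h4 : t ^+ 2 * (L * D) = t * D by rewrite expr2 mulrA -(mulrA t) tL mulr1.
  have h5 : 0 <= t * (r * B) by rewrite mulr_ge0 // ltW.
  lra.
have [||v1 v2|p] := eball_contraction_fixpoint T 0 nu q (ltW nu0).
- by rewrite q0.
- move=> v; rewrite /eball /= !subr0 => v_nu.
  have z_nu : enorm (0 : 'rV[R]_n) <= nu by rewrite enorm0 ltW.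
  have T0 : T 0 = t *: (w - r *: m 0).
    by apply/rowP => i; rewrite /T !mxE; ring.
  have := Tlip _ _ v_nu z_nu; rewrite T0 subr0.
  have := enormD (T v - t *: (w - r *: m 0)) (t *: (w - r *: m 0)).
  rewrite subrK enormZ gtr0_norm //; have := enorm_ge0 (w - r *: m 0); nra.
- by rewrite /eball /= !subr0; exact: Tlip.
rewrite /eball /= subr0 => p_nu Tp; exists p => //.
have /eqP : t *: (p + r *: m p - w) = 0.
  by rewrite -[t *: _](subKr p) -/(T p) Tp subrr.
by rewrite scaler_eq0 gt_eqF //= subr_eq0 => /eqP.
Qed.

End contraction.

(** * Uniform quadratic growth at the tilted minimisers *)

Section tilt_growth.
Context {R : realType} {n : nat}.
Variables (phi : 'rV[R]_n -> \bar R) (xb : 'rV[R]_n).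

(* [m] is the argmin map; [f v] is the finite value of [phi] at [m v]. *)
Record tilt_growth_spec (sigma nu delta : R) (m : 'rV[R]_n -> 'rV[R]_n)
    (f : 'rV[R]_n -> R) : Prop := TiltGrowthSpec {
  tilt_nu_gt0 : 0 < nu;
  tilt_delta_gt0 : 0 < delta;
  tilt_m0 : m 0 = xb;
  tilt_val : forall v, enorm v <= nu -> phi (m v) = (f v)%:E;
  tilt_lip : forall v1 v2, enorm v1 <= nu -> enorm v2 <= nu ->
    sigma * enorm (m v1 - m v2) <= enorm (v1 - v2);
  tilt_growth : forall v x, enorm v <= nu -> enorm (x - xb) <= delta ->
    ((f v + dot v (x - m v) + sigma / 2 * enorm (x - m v) ^+ 2)%:E <= phi x)%E
}.

(* [m v] is a subgradient at [v] of [g v = <v, m v> - f v]; halving the segment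
   improves the constant [c] of the quadratic upper bound to [c / 2 + k / 4],
   so [k / 2] is reached in the limit. *)
Lemma quadratic_upper_bound (g : 'rV[R]_n -> R) (m : 'rV[R]_n -> 'rV[R]_n)
    (nu k : R) :
  0 <= k ->
  (forall v v', enorm v <= nu -> enorm v' <= nu ->
    g v + dot (v' - v) (m v) <= g v') ->
  (forall v v', enorm v <= nu -> enorm v' <= nu ->
    enorm (m v - m v') <= k * enorm (v - v')) ->
  forall v v', enorm v <= nu -> enorm v' <= nu ->
    g v' <= g v + dot (v' - v) (m v) + k / 2 * enorm (v' - v) ^+ 2.
Proof.
move=> k0 sub lip.
have dot_lip v v' : enorm v <= nu -> enorm v' <= nu ->
    dot (v' - v) (m v' - m v) <= k * enorm (v' - v) ^+ 2.
  move=> v_nu v'_nu; apply: le_trans (dot_le_enorm _ _) _.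
  have := lip _ _ v'_nu v_nu; have := enorm_ge0 (v' - v); nra.
(* Closed form of the recursion [c / 2 + k / 4], started from the crude constant [k]. *)
have bound j : forall v v', enorm v <= nu -> enorm v' <= nu ->
    g v' <= g v + dot (v' - v) (m v)
      + (k / 2 + k / 2 * 2^-1 ^+ j) * enorm (v' - v) ^+ 2.
  elim: j => [|j IHj] v v' v_nu v'_nu.
    have := sub _ _ v'_nu v_nu; have := dot_lip _ _ v_nu v'_nu.
    by rewrite expr0 !dotE; lra.
  pose w := 2^-1 *: (v + v').
  have w_nu : enorm w <= nu.
    by rewrite /w enormZ gtr0_norm //; have := enormD v v'; lra.
  have wv : w - v = 2^-1 *: (v' - v).
    by apply/rowP => i; rewrite /w !mxE; field.
  have v'w : v' - w = 2^-1 *: (v' - v).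
    by apply/rowP => i; rewrite /w !mxE; field.
  have := IHj _ _ v_nu w_nu; have := IHj _ _ w_nu v'_nu.
  have := dot_lip _ _ v_nu w_nu; rewrite wv v'w.
  have -> : enorm (2^-1 *: (v' - v)) ^+ 2 = 2^-1 ^+ 2 * enorm (v' - v) ^+ 2.
    by rewrite enormZ gtr0_norm // exprMn.
  rewrite (exprS _ j) !dotZl dotDr dotNr; lra.
move=> v v' v_nu v'_nu.
have : g v + dot (v' - v) (m v)
    + (k / 2 + k / 2 * 2^-1 ^+ j) * enorm (v' - v) ^+ 2 @[j --> \oo] -->
    g v + dot (v' - v) (m v) + (k / 2 + k / 2 * 0) * enorm (v' - v) ^+ 2.
  apply: cvgD; first exact: cvg_cst.
  apply: cvgM; last exact: cvg_cst.
  apply: cvgD; first exact: cvg_cst.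
  apply: cvgM; first exact: cvg_cst.
  by apply: cvg_expr; rewrite gtr0_norm //; lra.
rewrite mulr0 addr0 => /cvgr_to_ge; apply.
by near=> j; exact: bound.
Unshelve. all: by end_near. Qed.

Lemma tilt_stable_growth (sigma a : R) :
  (forall x, phi x != -oo%E) -> 0 < sigma -> phi xb = a%:E ->
  tilt_stable_local_minimizer phi xb sigma^-1 ->
  exists nu delta m f, tilt_growth_spec sigma nu delta m f.
Proof.
move=> phiNy sigma0 phi_xb.
move=> [_ [gamma [gamma0 argmin0 [N [m [N0 argminN lip]]]]]].
have [nu nu0 nuN] := nbhs_enormP _ _ N0.
have {}argminN v : enorm v <= nu -> tilt_argmin phi xb gamma v (m v).
  by move=> v_nu; rewrite argminN //; apply: nuN; rewrite /eball /= subr0.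
have {}lip v1 v2 : enorm v1 <= nu -> enorm v2 <= nu ->
    enorm (m v1 - m v2) <= sigma^-1 * enorm (v1 - v2).
  by move=> v1nu v2nu; apply: lip; apply: nuN; rewrite /eball /= subr0.
have z_nu : enorm (0 : 'rV[R]_n) <= nu by rewrite enorm0 ltW.
have m0 : m 0 = xb by have := argminN _ z_nu; rewrite argmin0.
pose f v := fine (phi (m v)).
have phim v : enorm v <= nu -> phi (m v) = (f v)%:E.
  move=> /argminN.
  move=> /(tilt_argmin_fin _ _ _ _ _ _ phiNy (ltW gamma0) phi_xb)[b + _].
  by rewrite /f => ->.
have mmin v x : enorm v <= nu -> eball xb gamma x ->
    ((f v + dot v (x - m v))%:E <= phi x)%E.
  move=> v_nu xg; have [_ /(_ _ xg)] := argminN _ v_nu; rewrite phim //.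
  case: (phi x) (phiNy x) => [c||] // _; last by move=> _; rewrite leey.
  by rewrite -!EFinB !lee_fin !dotE; lra.
(* The conjugate of [phi] restricted to the [gamma]-ball, attained at [m v]. *)
pose g v := dot v (m v) - f v.
have ks : 0 <= sigma^-1 by rewrite invr_ge0 ltW.
have gsub v v' : enorm v <= nu -> enorm v' <= nu ->
    g v + dot (v' - v) (m v) <= g v'.
  move=> v_nu v'_nu; have := mmin v' (m v) v'_nu (argminN _ v_nu).1.
  by rewrite phim // lee_fin /g !dotE; lra.
have gub := quadratic_upper_bound g m nu _ ks gsub lip.
have sk : sigma * sigma^-1 = 1 by rewrite mulfV // gt_eqF.
have {}lip v1 v2 : enorm v1 <= nu -> enorm v2 <= nu ->
    sigma * enorm (m v1 - m v2) <= enorm (v1 - v2).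
  move=> /lip + /[dup] => /[apply] h _.
  by have := ler_wpM2l (ltW sigma0) h; rewrite mulrA sk mul1r.
(* Thirds: [v], [sigma (x - xb)] and [sigma (xb - m v)] each have norm at most [nu / 3], so the new
   tilt [v + sigma h] stays in the [nu]-ball. *)
exists (nu / 3), (Num.min gamma (nu / 3 / sigma)), m, f; split => //.
- by rewrite divr_gt0.
- by rewrite lt_min gamma0 !divr_gt0.
- by move=> v v_nu; apply: phim; lra.
- by move=> v1 v2 v1nu v2nu; apply: lip; lra.
move=> v x v_nu; rewrite le_min => /andP[xg xnu].
have {}xnu : sigma * enorm (x - xb) <= nu / 3 by rewrite mulrC -ler_pdivlMr.
have v_nu' : enorm v <= nu by lra.
(* The tilt [v' = v + sigma h] maximises [<v', x>] minus the quadratic upper bound of [g v']; the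
   gain is [sigma / 2 |h|^2]. *)
pose h := x - m v.
have v'_nu : enorm (v + sigma *: h) <= nu.
  apply: le_trans (enormD _ _) _; rewrite enormZ gtr0_norm //.
  have := enorm_triangle x xb (m v).
  rewrite -/h -m0 => /(ler_wpM2l (ltW sigma0)).
  have := lip _ _ z_nu v_nu'; rewrite sub0r enormN m0; lra.
apply: le_trans (mmin _ x v'_nu xg); rewrite lee_fin.
have := gub _ _ v_nu' v'_nu.
have -> : v + sigma *: h - v = sigma *: h by rewrite addrAC subrr add0r.
rewrite /g -/h.
have -> : x - m (v + sigma *: h) = h + m v - m (v + sigma *: h).
  by rewrite /h subrK.
rewrite (enormZ sigma h) gtr0_norm // exprMn.
have -> : sigma^-1 / 2 * (sigma ^+ 2 * enorm h ^+ 2) = sigma / 2 * enorm h ^+ 2.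
  by field; rewrite gt_eqF.
move: (m (v + sigma *: h)) (f (v + sigma *: h)) => p fp.
by clearbody h; rewrite enorm_sqr !dotE; lra.
Qed.

End tilt_growth.

(** * The strongly convex minorant and its subdifferential graph *)

Section tilt_variational_convexity.
Context {R : realType} {n : nat}.
Variables (phi : 'rV[R]_n -> \bar R) (xb : 'rV[R]_n).

Lemma tilt_growth_near (sigma nu delta : R) m f v :
  tilt_growth_spec phi xb sigma nu delta m f -> enorm v <= nu ->
  sigma * enorm (m v - xb) <= enorm v.
Proof.
move=> [nu0 _ m0 _ lip _] v_nu; rewrite -m0 -[v in leRHS]subr0.
by apply: lip => //; rewrite enorm0 ltW.
Qed.

(* Prox-regularity at [(u, v)] and growth at [(m w, w)], for the solution [w] of
   [w + (r + 1) m w = v + (r + 1) u], force [u = m w], hence [w = v]. *)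
Lemma prox_regular_subdiff_argmin (sigma nu delta eps r : R) m f :
  (forall x, phi x != -oo%E) -> 0 < sigma -> 0 < eps -> 0 <= r ->
  tilt_growth_spec phi xb sigma nu delta m f ->
  (forall x u v, enorm (x - xb) <= eps -> limiting_subdiff phi u v ->
    enorm (u - xb) <= eps -> enorm v <= eps -> (phi u < phi xb + eps%:E)%E ->
    (phi u + (dot v (x - u))%:E - (r / 2 * enorm (x - u) ^+ 2)%:E
      <= phi x)%E) ->
  exists2 eta, 0 < eta & forall u v, limiting_subdiff phi u v ->
    enorm (u - xb) <= eta -> enorm v <= eta ->
    (phi u < phi xb + eps%:E)%E -> u = m v.
Proof.
move=> phiNy sigma0 eps0 r0 spec prox.
have [nu0 delta0 m0 phim lip growth] := spec.
(* On the [nu']-ball, [m] takes values where both prox-regularity and growth apply. *)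
have [nu' [nu'0 nu'nu nu'eps nu'delta]] : exists nu', [/\ 0 < nu', nu' <= nu,
    nu' <= sigma * eps & nu' <= sigma * delta].
  exists (Num.min nu (Num.min (sigma * eps) (sigma * delta))); split.
  - by rewrite !lt_min nu0 !mulr_gt0.
  - by rewrite ge_min lexx.
  - by rewrite !ge_min lexx !orbT.
  - by rewrite !ge_min lexx !orbT.
have m_near v : enorm v <= nu' ->
    enorm (m v - xb) <= eps /\ enorm (m v - xb) <= delta.
  move=> v_nu'.
  have h := tilt_growth_near _ _ _ _ _ _ spec (le_trans v_nu' nu'nu).
  by split; rewrite -(ler_pM2l sigma0); lra.
have mono v1 v2 : enorm v1 <= nu' -> enorm v2 <= nu' ->
    0 <= dot (v1 - v2) (m v1 - m v2).
  move=> v1nu' v2nu'; have v1nu := le_trans v1nu' nu'nu.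
  have v2nu := le_trans v2nu' nu'nu.
  have := growth v1 (m v2) v1nu (m_near _ v2nu').2.
  have := growth v2 (m v1) v2nu (m_near _ v1nu').2.
  rewrite !phim // !lee_fin (enormB (m v2)) !dotE.
  by have := mulr_ge0 (ltW sigma0) (sqr_ge0 (enorm (m v1 - m v2))); lra.
have ks : 0 <= sigma^-1 by rewrite invr_ge0 ltW.
have {}lip v1 v2 : enorm v1 <= nu' -> enorm v2 <= nu' ->
    enorm (m v1 - m v2) <= sigma^-1 * enorm (v1 - v2).
  move=> v1nu' v2nu'; rewrite mulrC ler_pdivlMr // mulrC.
  by apply: lip; [exact: le_trans nu'nu|exact: le_trans nu'nu].
have r1 : 0 <= r + 1 by rewrite addr_ge0.
have [eta' eta'0 solve] :=
  monotone_lipschitz_shift_surj m nu' _ _ nu'0 ks r1 mono lip.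
(* The factor [r + 2] bounds [|v + (r + 1) (u - xb)|] by [eta']. *)
have [eta [eta0 eta_eps eta_delta eta_eta']] : exists eta, [/\ 0 < eta,
    eta <= eps, eta <= delta & (r + 2) * eta <= eta'].
  have r2 : 0 < r + 2 by lra.
  exists (Num.min eps (Num.min delta (eta' / (r + 2)))); split.
  - by rewrite !lt_min eps0 delta0 divr_gt0.
  - by rewrite ge_min lexx.
  - by rewrite !ge_min lexx !orbT.
  - by rewrite mulrC -ler_pdivlMr // !ge_min lexx !orbT.
exists eta => // u v uv u_eta v_eta phiu_lt.
have [b phiu] := dom_fin _ _ phiNy uv.1.
have [|w w_nu' wE] := solve (v + (r + 1) *: u).
  have -> : v + (r + 1) *: u - (r + 1) *: m 0 = v + (r + 1) *: (u - xb).
    by rewrite m0 scalerBr addrA.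
  apply: le_trans (enormD _ _) _; rewrite enormZ ger0_norm //.
  by have := ler_wpM2l r1 u_eta; lra.
have w_nu := le_trans w_nu' nu'nu.
have := growth w u w_nu (le_trans u_eta eta_delta).
have := prox (m w) u v (m_near _ w_nu').1 uv (le_trans u_eta eta_eps)
  (le_trans v_eta eta_eps) phiu_lt.
rewrite phim // phiu -!EFinD !lee_fin (enormB (m w)).
have wv : w = v + (r + 1) *: (u - m w).
  by rewrite scalerBr addrA -wE addrK.
have -> : dot w (u - m w) =
    dot v (u - m w) + (r + 1) * enorm (u - m w) ^+ 2.
  by rewrite {1}wv dotDl dotZl enorm_sqr.
have -> : dot v (m w - u) = - dot v (u - m w) by rewrite -dotNr opprB.
(* The sum of [h1] and [h2] is [(r / 2 + 1 + sigma / 2) |u - m w|^2 <= 0]. *)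
move=> h1 h2.
have h3 := mulr_ge0 r0 (sqr_ge0 (enorm (u - m w))).
have h4 := mulr_ge0 (ltW sigma0) (sqr_ge0 (enorm (u - m w))).
have /eqP : enorm (u - m w) ^+ 2 = 0.
  by apply/eqP; rewrite eq_le sqr_ge0 andbT; lra.
rewrite sqrf_eq0 => /eqP/enorm0_eq0 um0.
rewrite um0 scaler0 addr0 in wv.
by move/eqP: um0; rewrite subr_eq0 wv => /eqP.
Qed.

Lemma tilt_stable_variationally_strongly_convex (sigma : R) :
  (forall x, phi x != -oo%E) -> dom phi xb -> 0 < sigma ->
  limiting_subdiff phi xb 0 -> prox_regular phi xb 0 ->
  tilt_stable_local_minimizer phi xb sigma^-1 ->
  variationally_strongly_convex phi xb 0 sigma.
Proof.
move=> phiNy xb_dom sigma0 phi0 [lsc_phi _ [eps [r [eps0 r0 prox]]]] tilt.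
split => //; have [a phi_xb] := dom_fin _ _ phiNy xb_dom.
have [nu [delta [m [f spec]]]] :=
  tilt_stable_growth _ _ _ _ phiNy sigma0 phi_xb tilt.
have [eta eta0 gphm] : exists2 eta, 0 < eta & forall u v,
    limiting_subdiff phi u v -> enorm (u - xb) <= eta -> enorm v <= eta ->
    (phi u < phi xb + eps%:E)%E -> u = m v.
  apply: prox_regular_subdiff_argmin phiNy sigma0 eps0 r0 spec _.
  move=> x u v xe uv ue ve; apply: prox => //.
  by rewrite /eball /= subr0.
have [nu0 delta0 m0 phim lip growth] := spec.
(* [2 rho <= sigma delta] puts [m v] inside the open [delta]-ball, and [2 rho delta <= eps] keeps
   [phi (m v)] below [phi xb + eps]. *)
have [rho [[rho0 rho_eta rho_nu rho_delta rho_sd] rho_eps]] : exists rho,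
    [/\ 0 < rho, rho <= eta, rho <= nu, rho <= delta &
     2 * rho <= sigma * delta] /\ 2 * (rho * delta) <= eps.
  exists (Num.min (Num.min eta nu)
    (Num.min delta (Num.min (sigma * delta / 2) (eps / 2 / delta)))); split.
    split.
    - by rewrite !lt_min eta0 nu0 delta0 !divr_gt0 // mulr_gt0.
    - by rewrite !ge_min lexx.
    - by rewrite !ge_min lexx !orbT.
    - by rewrite !ge_min lexx !orbT.
    - by rewrite mulrC -ler_pdivlMr // !ge_min lexx !orbT.
  by rewrite mulrC -ler_pdivlMr // -ler_pdivlMr // !ge_min lexx !orbT.
pose U := eball xb rho; pose V := eball (0 : 'rV[R]_n) rho.
have Vnu v : V v -> enorm v <= nu.
  by rewrite /V /eball /= subr0 => v_rho; exact: le_trans rho_nu.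
have m_near v : V v -> enorm (m v - xb) < delta.
  move=> Vv; have := tilt_growth_near _ _ _ _ _ _ spec (Vnu v Vv).
  move: Vv; rewrite /V /eball /= subr0 -(ltr_pM2l sigma0).
  by have := mulr_gt0 sigma0 delta0; lra.
have f_lt v : V v -> f v < a + eps.
  move=> Vv; have := growth v xb (Vnu v Vv).
  rewrite subrr enorm0 phi_xb lee_fin => /(_ (ltW delta0)).
  have := dot_le_enorm v (m v - xb); rewrite -(opprB xb) dotNr => h1 h2.
  have := sqr_ge0 (enorm (xb - m v)).
  move: (Vv) (m_near v Vv); rewrite /V /eball /= subr0 -(opprB xb) => h3 h4.
  have h5 : enorm v * enorm (- (xb - m v)) <= rho * delta.
    by apply: ler_pM; rewrite ?enorm_ge0 // ltW.
  by have := sqr_ge0 (enorm (xb - m v)); nra.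
pose l v x := f v + dot v (x - m v) + sigma / 2 * enorm (x - m v) ^+ 2.
pose psi x := ereal_sup [set (l v x)%:E | v in V].
have psi_ge v x : V v -> ((l v x)%:E <= psi x)%E.
  by move=> Vv; apply: ereal_sup_ubound; exists v.
have psi_le x : enorm (x - xb) <= delta -> (psi x <= phi x)%E.
  move=> xd; apply: ge_ereal_sup => _ [v Vv <-].
  exact: growth (Vnu v Vv) xd.
have V0 : V 0 by rewrite /V /eball /= subr0 enorm0 ltW.
have psiNy x : psi x != -oo%E.
  by rewrite -ltNye; apply: lt_le_trans (psi_ge 0 x V0); rewrite ltNyr.
have lm v : l v (m v) = f v.
  by rewrite /l subrr dot0r enorm0 expr0n mulr0 !addr0.
have psim v : V v -> psi (m v) = (f v)%:E.
  move=> Vv; apply/eqP; rewrite eq_le -(phim _ (Vnu v Vv)).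
  rewrite psi_le ?(ltW (m_near v Vv)) //=.
  by rewrite (phim _ (Vnu v Vv)) -lm psi_ge.
have psi_lsc : lower_semicontinuous psi.
  move=> x c /ereal_sup_gt[_ [v Vv <-]]; rewrite lte_fin => cl.
  have lC : l v y @[y --> x] --> l v x.
    have e := enormB_continuous (m v) x.
    have d : dot v (y - m v) @[y --> x] --> dot v (x - m v).
      rewrite dotDr; under eq_fun do rewrite dotDr.
      exact: (cvgD (dot_continuous v x) (cvg_cst _)).
    exact: (cvgD (cvgD (cvg_cst _) d) (cvgM (cvg_cst _) (cvgM e e))).
  exists [set y | c < l v y]; first exact: (cvgr_gt _ lC).
  by move=> y cy; apply: lt_le_trans (psi_ge v y Vv); rewrite lte_fin.
(* Each [l v] minus [sigma / 2 |x|^2] is affine, and a supremum of affine functions is convex. *)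
have psi_conv : strongly_convex_on setT sigma psi.
  move=> x y t _ _ /andP[t0 t1].
  rewrite leeBlDr //; apply: ge_ereal_sup => _ [v Vv <-].
  rewrite -leeBlDr // -EFinB.
  have -> : l v (t *: x + (1 - t) *: y)
      - sigma / 2 * enorm (t *: x + (1 - t) *: y) ^+ 2 =
    t * (l v x - sigma / 2 * enorm x ^+ 2)
    + (1 - t) * (l v y - sigma / 2 * enorm y ^+ 2).
    by rewrite /l !enorm_sqr !dotE !(dotC (m v)) (dotC y x); lra.
  rewrite EFinD !EFinM; apply: leeD; apply: lee_wpmul2l;
    rewrite ?lee_fin ?subr_ge0 // EFinB; exact: leeB (psi_ge _ _ Vv) _.
have psi_sub v : V v -> limiting_subdiff psi (m v) v.
  move=> Vv; apply: sub_frechet_limiting.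
  apply: (frechet_subdiffI _ _ _ _ 0 (psim v Vv)).
  apply: (@filterE _ (nbhs (m v))) => x.
  apply: le_trans (psi_ge v x Vv); rewrite lee_fin /l mul0r subr0 lerDl.
  by rewrite mulr_ge0 ?sqr_ge0 // divr_ge0 // ltW.
have phi_sub v : V v -> limiting_subdiff phi (m v) v.
  move=> Vv; apply: sub_frechet_limiting.
  apply: (frechet_subdiffI _ _ _ _ 0 (phim v (Vnu v Vv))).
  have := near_eball _ _ _ (m_near v Vv).
  apply: (@filterS _ (nbhs (m v))) => x xd.
  apply: le_trans (growth v x (Vnu v Vv) xd); rewrite lee_fin mul0r subr0 lerDl.
  by rewrite mulr_ge0 ?sqr_ge0 // divr_ge0 // ltW.
(* [u] and [m v] share the [psi]-subgradient [v], so strong monotonicity makes them equal. *)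
have gph_psi u v : V v -> limiting_subdiff psi u v -> u = m v.
  move=> Vv uv; have := strongly_convex_subdiff_monotone _ _ _ _ _ _ _ psiNy
    sigma0 psi_conv filterT filterT uv (psi_sub v Vv).
  rewrite subrr dot0l pmulr_rle0 // => h; apply/eqP; rewrite -subr_eq0.
  apply/eqP/enorm0_eq0/eqP; rewrite -sqrf_eq0; apply/eqP/le_anti.
  by rewrite h sqr_ge0.
have gph_phi u v : U u -> V v -> (phi u < phi xb + eps%:E)%E ->
    limiting_subdiff phi u v -> u = m v.
  move=> Uu Vv phiu uv; apply: gphm => //; first exact: le_trans rho_eta.
  by move: Vv; rewrite /V /eball /= subr0 => h; exact: le_trans rho_eta.
exists U, V, psi, eps; split => //.
- split; [exact: nbhs_eball|exact: convex_eball|exact: nbhs_eball|].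
  exact: convex_eball.
- split => //.
  + by split => //; exists (m 0); rewrite /dom /= psim // ltry.
  + by move=> x Ux; apply: psi_le; exact: le_trans rho_delta.
  + by move=> x y t _ _; exact: psi_conv.
(* Both localized graphs are described by [u = m v]. *)
- apply/seteqP; split => -[u v] [[/= Uu Vv] uv].
    case: Uu => Uu phiu; split => //; rewrite /gph /=.
    by rewrite (gph_phi u v Uu Vv phiu uv); exact: psi_sub.
  have um := gph_psi u v Vv uv.
  split; last by rewrite /gph /= um; exact: phi_sub.
  split => //=; split => //.
  by rewrite um phim ?phi_xb ?lte_fin ?f_lt //; exact: Vnu.
move=> u v [[/= [Uu phiu] Vv] uv].
by rewrite (gph_phi u v Uu Vv phiu uv) psim // phim //; exact: Vnu.
Qed.

End tilt_variational_convexity.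

Theorem proposition2p9 (R : realType) (n : nat) (phi : 'rV[R]_n -> \bar R)
    (xb : 'rV[R]_n) (sigma : R)
    (phi_proper : proper_function phi)
    (xb_dom : dom phi xb)
    (subdiff0 : limiting_subdiff phi xb 0)
    (phi_reg : continuously_prox_regular phi xb 0)
    (sigma_gt0 : 0 < sigma) :
  (variationally_strongly_convex phi xb 0 sigma <->
   tilt_stable_local_minimizer phi xb sigma^-1) /\
  (tilt_stable_local_minimizer phi xb sigma^-1 <->
   locally_strongly_monotone (limiting_subdiff phi) xb 0 sigma).
Proof.
have [phiNy _] := phi_proper; have [phi_prox phi_cont] := phi_reg.
have mono_tilt := monotone_tilt_stable _ _ _
  phiNy xb_dom sigma_gt0 subdiff0 phi_prox.
have tilt_convex := tilt_stable_variationally_strongly_convex _ _ _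
  phiNy xb_dom sigma_gt0 subdiff0 phi_prox.
have convex_mono := variationally_strongly_convex_monotone _ _ _
  phiNy sigma_gt0 subdiff0 phi_cont.
split; split => //; first by move=> /convex_mono.
by move=> /tilt_convex.
Qed.
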